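(* Let $\mathcal{I}$ be a finite nonempty set of zones and fix a stage $t$. Let $t_{ij}>0$ ($i,j\in\mathcal{I}$) be travel times, $N^v_{i,t}>0$ the number of idle vehicles in zone $i$, $w^p_{i,t}=\phi/\sqrt{N^v_{i,t}}$ with $\phi>0$ the passenger waiting time in zone $i$, and $r_{ij,t}\ge 0$ the rebalancing flows. For any $q_{ij,t}>0$, $i,j\in\mathcal{I}$, let $P_t=[P_{ij,t}]_{i,j\in\mathcal{I}}$ be the corresponding transition matrix (as defined in the context). Then the stationary charging demand distribution exists and is unique: there is exactly one row vector $n_t=[n_{i,t}]_{i\in\mathcal{I}}$ with $n_{i,t}>0$ for all $i\in\mathcal{I}$ and $\sum_{i\in\mathcal{I}}n_{i,t}=1$ satisfying $$n_tP_t=n_t.$$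
   Context: Electric vehicles (EVs) of a ride-hailing fleet move among zones. Here $q_{ij,t}$ is the passenger arrival rate from zone $i$ to zone $j$ and $r_{ij,t}$ is the rate of empty vehicles relocated from $i$ to $j$. The average number of EVs travelling from zone $i$ to zone $j$ is $$D_{ij,t}=\begin{cases}N^v_{i,t}+\sum_{j'\in\mathcal{I}}q_{ij',t}\,w^p_{i,t}+q_{ij,t}t_{ij}+r_{ij,t}t_{ij}, & i=j,\\ q_{ij,t}t_{ij}+r_{ij,t}t_{ij}, & i\ne j,\end{cases}$$ and the transition matrix $P_t$ is $$P_{ij,t}=\frac{D_{ij,t}}{\sum_{j'\in\mathcal{I}}D_{ij',t}}.$$ The stationary charging demand distribution $n_t$ is the row vector of (positive) equilibrium probabilities of an EV staying in each zone, with entries summing to $1$, determined by $n_tP_t=n_t$. *)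

(* Defs.v *)
From mathcomp Require Import all_boot all_order all_algebra reals.

Set Implicit Arguments.
Unset Strict Implicit.
Unset Printing Implicit Defensive.

Import Order.TTheory GRing.Theory Num.Theory.
Local Open Scope ring_scope.

(* Zones are labelled by 'I_m.  All quantities are those of one fixed stage:
   [tau i j] is the travel time t_ij, [N i] the number of idle vehicles,
   [q i j] the passenger arrival rate and [r i j] the relocation rate. *)

Definition waiting_time (R : realType) (m : nat) (phi : R) (N : 'I_m -> R)
    (i : 'I_m) : R :=
  phi / Num.sqrt (N i).

Definition avg_vehicles (R : realType) (m : nat) (tau : 'I_m -> 'I_m -> R)
    (N w : 'I_m -> R) (q r : 'I_m -> 'I_m -> R) (i j : 'I_m) : R :=
  if i == j then
    N i + (\sum_(j' < m) q i j' * w i) + q i j * tau i j + r i j * tau i j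
  else
    q i j * tau i j + r i j * tau i j.

Definition transition_matrix (R : realType) (m : nat)
    (tau : 'I_m -> 'I_m -> R) (N w : 'I_m -> R) (q r : 'I_m -> 'I_m -> R) :
    'M[R]_m :=
  \matrix_(i < m, j < m)
    (avg_vehicles tau N w q r i j /
     \sum_(j' < m) avg_vehicles tau N w q r i j').

Definition stationary_distribution (R : realType) (m : nat) (P : 'M[R]_m)
    (n : 'rV[R]_m) : Prop :=
  [/\ forall i : 'I_m, 0 < n 0 i, \sum_(i < m) n 0 i = 1 & n *m P = n].

(* Main.v *)
Require Import Defs.
From mathcomp Require Import all_boot all_order all_algebra reals.

Set Implicit Arguments.
Unset Strict Implicit.
Unset Printing Implicit Defensive.

Import Order.TTheory GRing.Theory Num.Theory.
Local Open Scope ring_scope.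

(** Since [P] is row stochastic, 1 is an eigenvalue, so some [v != 0] satisfies
    [v P = v]. By the triangle inequality [|v| <= |v| P] entrywise, and both sides
    have the same total mass, so [|v|] is fixed as well. As [P] has positive
    entries, a nonnegative nonzero fixed vector is positive: normalizing [|v|]
    gives existence. For uniqueness, the difference [d] of two solutions makes
    [|d| + d] a nonnegative fixed vector, hence zero or positive; either way [d] has
    constant sign, and its entries sum to 0. *)

Section PositiveStochastic.
Variables (R : realFieldType) (m : nat) (P : 'M[R]_m).
Hypothesis P_gt0 : forall i j, 0 < P i j.
Hypothesis P_sum1 : forall i, \sum_j P i j = 1.

Lemma sum_mulmx_stochastic (v : 'rV[R]_m) :
  \sum_j (v *m P) 0 j = \sum_i v 0 i.
Proof.
under eq_bigr do rewrite mxE.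
rewrite exchange_big; apply: eq_bigr => i _.
by rewrite -mulr_sumr P_sum1 mulr1.
Qed.

(** Unit row sums put the all-ones column in the right kernel of [P - 1]; this square matrix is
    therefore singular and has a left kernel too. *)
Lemma fixed_vector_exists : (0 < m)%N ->
  exists2 v : 'rV[R]_m, v != 0 & v *m P = v.
Proof.
move=> m_gt0; pose A := P - 1%:M.
have A1 : A *m const_mx 1 = 0 :> 'cV[R]_m.
  apply/eqP; rewrite mulmxBl mul1mx subr_eq0; apply/eqP/matrixP => i j.
  rewrite !mxE -[RHS](P_sum1 i); apply: eq_bigr => k _.
  by rewrite mxE mulr1.
(* Were [A] invertible, cancelling it in [A1] would make the all-ones column zero; [m_gt0] supplies
   an entry where this reads 1 = 0. *)
have : kermx A != 0.
  rewrite kermx_eq0 row_free_unit; apply/negP => /mulKmx/(_ (const_mx 1)).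
  move/(_ 1%N); rewrite A1 mulmx0 => /matrixP/(_ (Ordinal m_gt0) 0)/eqP.
  by rewrite !mxE eq_sym oner_eq0.
case/rowV0Pn => v /sub_kermxP vA v_neq0; exists v => //.
by apply/eqP; rewrite -subr_eq0 -[X in _ - X]mulmx1 -mulmxBr vA.
Qed.

Lemma fixed_norm (v : 'rV[R]_m) :
  v *m P = v -> map_mx Num.norm v *m P = map_mx Num.norm v.
Proof.
move=> vP; set u := map_mx _ _.
have le_u j : u 0 j <= (u *m P) 0 j.
  rewrite mxE -[in leLHS]vP !mxE; apply: le_trans (ler_norm_sum _ _ _) _.
  by apply: ler_sum => i _; rewrite normrM mxE (gtr0_norm (P_gt0 i j)).
(* The gaps in [le_u] are nonnegative and add up to 0, so each of them vanishes. *)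
have sum0 : \sum_j ((u *m P) 0 j - u 0 j) = 0.
  by rewrite sumrB sum_mulmx_stochastic subrr.
apply/rowP => j; apply/eqP; rewrite -subr_eq0; apply/eqP.
by apply: (psumr_eq0P _ sum0) => // k _; rewrite subr_ge0.
Qed.

(** A single positive entry [w 0 k] already contributes [w 0 k * P k i > 0] to every entry of
    [w *m P = w]. *)
Lemma fixed_nonneg_gt0 (w : 'rV[R]_m) :
  w *m P = w -> (forall i, 0 <= w 0 i) -> w != 0 -> forall i, 0 < w 0 i.
Proof.
move=> wP w_ge0 /rV0Pn[k wk_neq0] i.
have term_ge0 l : 0 <= w 0 l * P l i by rewrite mulr_ge0 // ltW.
rewrite -wP mxE (bigD1 k) //= ltr_pwDl ?sumr_ge0 //.
by rewrite mulr_gt0 // lt0r wk_neq0 w_ge0.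
Qed.

(** This is uniqueness in linear form: the difference of two stationary distributions is such a
    [d]. *)
Lemma fixed_sum0_eq0 (d : 'rV[R]_m) :
  d *m P = d -> \sum_i d 0 i = 0 -> d = 0.
Proof.
move=> dP d_sum0; pose w := map_mx Num.norm d + d.
have wE i : w 0 i = `|d 0 i| + d 0 i by rewrite !mxE.
have wP : w *m P = w by rewrite mulmxDl fixed_norm ?dP.
have w_ge0 i : 0 <= w 0 i by rewrite wE -lerBlDr sub0r -normrN ler_norm.
have [w0 | w_neq0] := eqVneq w 0.
  have d_le0 i : 0 <= - d 0 i.
    have /eqP := wE i; rewrite w0 mxE eq_sym addr_eq0 => /eqP <-.
    exact: normr_ge0.
  have Nd_sum0 : \sum_i - d 0 i = 0 by rewrite sumrN d_sum0 oppr0.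
  apply/rowP => i; rewrite mxE; apply/eqP; rewrite -oppr_eq0; apply/eqP.
  by apply: (psumr_eq0P _ Nd_sum0).
have w_gt0 := fixed_nonneg_gt0 wP w_ge0 w_neq0.
(* A negative entry of [d] would cancel against its absolute value and give [w] a zero entry. *)
have d_ge0 i : 0 <= d 0 i.
  rewrite leNgt; apply/negP => di_lt0.
  by have := w_gt0 i; rewrite wE ltr0_norm // addNr ltxx.
by apply/rowP => i; rewrite mxE; apply: (psumr_eq0P _ d_sum0).
Qed.

End PositiveStochastic.

Lemma stationary_distribution_exists_unique (R : realType) (m : nat)
    (P : 'M[R]_m) :
  (0 < m)%N -> (forall i j, 0 < P i j) -> (forall i, \sum_j P i j = 1) ->
  exists! n, stationary_distribution P n.
Proof.
move=> m_gt0 P_gt0 P_sum1.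
have [v v_neq0 vP] := fixed_vector_exists P_sum1 m_gt0.
pose u := map_mx Num.norm v.
have uP : u *m P = u by exact: fixed_norm.
have u_neq0 : u != 0.
  by have /rV0Pn[k vk] := v_neq0; apply/rV0Pn; exists k; rewrite mxE normr_eq0.
have u_gt0 : forall i, 0 < u 0 i.
  by apply: (fixed_nonneg_gt0 P_gt0 uP) => // i; rewrite mxE.
pose s := \sum_i u 0 i.
have s_gt0 : 0 < s.
  rewrite /s (bigD1 (Ordinal m_gt0)) //= ltr_pwDl ?sumr_ge0 // => i _.
  exact: ltW.
have su_sum1 : \sum_i (s^-1 *: u) 0 i = 1.
  by under eq_bigr do rewrite mxE; rewrite -mulr_sumr mulVf ?gt_eqF.
exists (s^-1 *: u); split=> [|n [_ n_sum1 nP]].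
  split=> [i||]; rewrite -?scalemxAl ?uP //.
  by rewrite mxE mulr_gt0 ?invr_gt0.
apply/eqP; rewrite -subr_eq0; apply/eqP/(fixed_sum0_eq0 P_gt0 P_sum1).
  by rewrite mulmxBl -scalemxAl uP nP.
under eq_bigr do rewrite mxE [X in _ + X]mxE.
by rewrite sumrB su_sum1 n_sum1 subrr.
Qed.

Theorem proposition1 (R : realType) (m : nat) (hm : (0 < m)%N)
    (tau : 'I_m -> 'I_m -> R) (htau : forall i j : 'I_m, 0 < tau i j)
    (N : 'I_m -> R) (hN : forall i : 'I_m, 0 < N i)
    (phi : R) (hphi : 0 < phi)
    (r : 'I_m -> 'I_m -> R) (hr : forall i j : 'I_m, 0 <= r i j)
    (q : 'I_m -> 'I_m -> R) (hq : forall i j : 'I_m, 0 < q i j) :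
  exists! n : 'rV[R]_m,
    stationary_distribution
      (transition_matrix tau N (waiting_time phi N) q r) n.
Proof.
set D := avg_vehicles tau N (waiting_time phi N) q r.
have D_gt0 i j : 0 < D i j.
  have flow_gt0 : 0 < q i j * tau i j + r i j * tau i j.
    by rewrite ltr_pwDl ?mulr_gt0 // mulr_ge0 // ltW.
  (* Off the diagonal this is [flow_gt0]; on it, the idle vehicles and the nonnegative waiting term
     are added. *)
  rewrite /D /avg_vehicles; case: ifP => // _; rewrite -addrA addr_gt0 //.
  rewrite ltr_pwDl // sumr_ge0 // => k _.
  by rewrite mulr_ge0 ?divr_ge0 ?sqrtr_ge0 // ltW.
have S_gt0 i : 0 < \sum_j D i j.
  rewrite (bigD1 i) //= ltr_pwDl ?sumr_ge0 // => j _; exact: ltW.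
apply: stationary_distribution_exists_unique => // [i j | i].
  by rewrite mxE divr_gt0.
under eq_bigr do rewrite mxE.
by rewrite -mulr_suml divff ?gt_eqF.
Qed.
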